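(* Let $G$ be a factor-critical graph with at least $7$ vertices. Then $G$ is an edge-stable equimatchable graph if and only if $G$ is a complete graph on an odd number of vertices, or $G\in\mathcal{G}_1$, or $G\in\mathcal{G}_2$, where: $\mathcal{G}_1$ is the family of graphs isomorphic to $K_{2r+1}\setminus M$ for some integer $r\ge 3$ and some nonempty matching $M$ of $K_{2r+1}$ (i.e. the complete graph on $2r+1$ vertices with the edges of $M$ removed); $\mathcal{G}_2$ is the family of graphs $G$ admitting an independent set $S$ with $|S|\ge 3$ such that every vertex of $S$ is adjacent to every vertex of $V(G)\setminus S$, and such that the maximum matching size of the induced subgraph $G[V(G)\setminus S]$ equals $1$.
   Context: All graphs are finite and simple. A matching is maximal if no other matching properly contains it. A graph $G$ is equimatchable if every maximal matching of $G$ has the same cardinality. An equimatchable graph $G$ is edge-stable (an ESE-graph) if $G\setminus e=(V(G),E(G)\setminus\{e\})$ is equimatchable for every $e\in E(G)$. A graph $G$ is factor-critical if $G-v$ has a perfect matching for every $v\in V(G)$. $\nu(H)$ denotes the maximum size of a matching of $H$. *)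

(* Defs.v *)
(* A finite simple graph is a symmetric irreflexive
   relation e : rel T on a finType T (vertex set = T). Edges are
   represented as 2-element sets [set x; y]. *)
From mathcomp Require Import all_boot.
Set Implicit Arguments. Unset Strict Implicit. Unset Printing Implicit Defensive.

Section Graphs.
Variable T : finType.

Definition matching (e : rel T) (M : {set {set T}}) : bool :=
  [forall f in M, exists x, exists y, [&& x != y, e x y & f == [set x; y]]] &&
  [forall f in M, forall g in M, (f != g) ==> [disjoint f & g]].

Definition maximal_matching (e : rel T) (M : {set {set T}}) : Prop :=
  matching e M /\ forall M' : {set {set T}}, matching e M' -> ~ (M \proper M').

Definition equimatchable (e : rel T) : Prop :=
  forall M1 M2 : {set {set T}}, maximal_matching e M1 -> maximal_matching e M2 ->
    #|M1| = #|M2|.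

Definition del_edge (e : rel T) (u v : T) : rel T :=
  fun x y => e x y && ([set x; y] != [set u; v]).

Definition ESE (e : rel T) : Prop :=
  equimatchable e /\ forall u v, e u v -> equimatchable (del_edge e u v).

(* induced subgraph G[A] (vertices outside A become isolated, which does not
   affect matchings) *)
Definition induce (e : rel T) (A : {set T}) : rel T :=
  fun x y => [&& e x y, x \in A & y \in A].

Definition covered (M : {set {set T}}) : {set T} := \bigcup_(f in M) f.

Definition factor_critical (e : rel T) : Prop :=
  forall v : T, exists M : {set {set T}},
    matching (induce e (~: [set v])) M /\ covered M = ~: [set v].

Definition nu (e : rel T) : nat :=
  \max_(M : {set {set T}} | matching e M) #|M|.

Definition complete_odd (e : rel T) : Prop :=
  (forall x y : T, x != y -> e x y) /\ odd #|T|.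

End Graphs.

Definition complete_rel (T : finType) : rel T := fun x y => x != y.

Definition in_G1 (T : finType) (e : rel T) : Prop :=
  exists r : nat, 3 <= r /\
  exists f : T -> 'I_(2 * r + 1), bijective f /\
  exists M : {set {set 'I_(2 * r + 1)}},
    [/\ matching (@complete_rel _) M, M != set0 &
        forall x y : T, e x y = (f x != f y) && ([set f x; f y] \notin M)].

Definition in_G2 (T : finType) (e : rel T) : Prop :=
  exists S : {set T},
    [/\ (forall x y, x \in S -> y \in S -> ~~ e x y),
        3 <= #|S|,
        (forall x y, x \in S -> y \notin S -> e x y) &
        nu (induce e (~: S)) = 1].

(* Main.v *)
(** Factor-criticality makes [|T|] odd and gives near-perfect matchings, so [G] is
    edge-stable equimatchable iff every matching that leaves at least three vertices
    uncovered leaves at least two edges among them; for the direct implication only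
    uncovered triples are used.

    If no vertex has two non-neighbours, [G] is complete or lies in G1.  Otherwise a
    seven-vertex argument produces an independent triple.  Let [S] be a maximum
    independent set, [v] in [S], and [p] the involution given by a perfect matching of
    [G - v].  Then [S' = p (S \ v)] is independent and completely joined to [S].  The
    triple condition on seven vertices shows that every matching edge [{x, p x}] outside
    [S] and [S'] is of one of two types: either both ends are completely joined to [S], or
    (up to swapping the ends) [x] behaves like a vertex of [S'] and [p x] is completely
    joined to [S'].  On nine vertices, together with the maximality of [S], it excludes
    two such edges, and counting gives at least one.  Hence [G] is in G2, with independent
    set [S] for the first type and [S' + x] for the second. *)
Require Import Defs.
From mathcomp Require Import all_boot.
From mathcomp Require Import zify.
Set Implicit Arguments. Unset Strict Implicit. Unset Printing Implicit Defensive.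

(** * Matchings, covered vertices and maximality *)

Section Matchings.
Variable T : finType.
Implicit Types (e : rel T) (M : {set {set T}}) (A S : {set T}) (s L : seq T).

Lemma matchingP e M :
  reflect ((forall f, f \in M -> exists x y, [/\ x != y, e x y & f = [set x; y]])
           /\ trivIset M) (matching e M).
Proof.
apply: (iffP andP) => [[/forall_inP hM hd]|[hM /trivIsetP hd]]; split.
- move=> f /hM /existsP[x /existsP[y /and3P[xy exy /eqP->]]].
  by exists x, y.
- apply/trivIsetP => f g fM gM fg.
  by move/forall_inP: hd => /(_ f fM) /forall_inP /(_ g gM); rewrite fg.
- apply/forall_inP => f /hM [x [y [xy exy ->]]].
  by apply/existsP; exists x; apply/existsP; exists y; rewrite xy exy eqxx.
- apply/forall_inP => f fM; apply/forall_inP => g gM.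
  by apply/implyP; apply: hd.
Qed.

Lemma sub_matching e1 e2 M :
  (forall f x y, f \in M -> f = [set x; y] -> e1 x y -> e2 x y) ->
  matching e1 M -> matching e2 M.
Proof.
move=> he /matchingP[hM hd]; apply/matchingP; split => // f fM.
by have [x [y [xy exy fE]]] := hM f fM; exists x, y; split=> //; apply: he fE exy.
Qed.

Lemma mem_covered M x : reflect (exists2 f, f \in M & x \in f) (x \in covered M).
Proof.
by apply: (iffP bigcupP) => -[f fM xf]; exists f.
Qed.

Lemma card_covered e M : matching e M -> #|covered M| = 2 * #|M|.
Proof.
move=> /matchingP[hM /eqP <-].
rewrite mulnC -sum_nat_const; apply: eq_bigr => f /hM [x [y [xy _ ->]]].
by rewrite cards2 xy.
Qed.

Lemma matchingU1 e M x y : matching e M -> x \notin covered M -> y \notin covered M ->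
  x != y -> e x y -> matching e ([set x; y] |: M).
Proof.
move=> /matchingP[hM /trivIsetP hd] xM yM xy exy; apply/matchingP; split.
  by move=> f /setU1P[->|/hM //]; exists x, y.
have disj f : f \in M -> [disjoint [set x; y] & f].
  move=> fM; apply/pred0P => z /=; apply/negP => /andP[/set2P[]-> zf].
    by case/negP: xM; apply/mem_covered; exists f.
  by case/negP: yM; apply/mem_covered; exists f.
apply/trivIsetP => f g /setU1P[->|fM] /setU1P[->|gM] fg.
- by rewrite eqxx in fg.
- exact: disj.
- by rewrite disjoint_sym; apply: disj.
- exact: hd.
Qed.

(** An edge of a larger matching that is not in [M] is disjoint from every edge of [M], so both its
    ends are uncovered and adjacent. *)
Lemma maximal_matching_indep e M : matching e M ->
  (forall x y, x \notin covered M -> y \notin covered M -> ~~ e x y) ->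
  maximal_matching e M.
Proof.
move=> mM ind; split=> // M' /matchingP[hM' /trivIsetP hd'] /properP[sMM' [f fM' fM]].
have [x [y [xy exy fE]]] := hM' f fM'.
have unc z : z \in f -> z \notin covered M.
  move=> zf; apply/negP => /mem_covered[g gM zg].
  have /(hd' f g fM' (subsetP sMM' g gM)) : f != g.
    by apply: contraNneq fM => ->.
  by move/pred0P => /(_ z) /=; rewrite zf zg.
suff: ~~ e x y by rewrite exy.
by apply: ind; apply: unc; rewrite fE !inE eqxx ?orbT.
Qed.

Lemma maximal_matching_uncovered e M x y : irreflexive e -> maximal_matching e M ->
  x \notin covered M -> y \notin covered M -> ~~ e x y.
Proof.
move=> irr [mM maxM] xM yM; apply/negP => exy.
have xy : x != y by apply: contraTneq exy => ->; rewrite irr.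
apply: (maxM _ (matchingU1 mM xM yM xy exy)).
apply/properP; split; first exact: subsetUr.
exists [set x; y]; first exact: setU11.
by apply: contra xM => xyM; apply/mem_covered; exists [set x; y] => //; rewrite setU11.
Qed.

(** * A sufficient condition for edge-stability *)

(** By parity the number of uncovered vertices is odd, and for a maximal matching it cannot reach
    three; so every maximal matching misses exactly one vertex. *)
Lemma equimatchable_odd e : irreflexive e -> odd #|T| ->
  (forall M, matching e M -> 3 <= #|~: covered M| ->
     exists x y, [/\ x \notin covered M, y \notin covered M & e x y]) ->
  equimatchable e.
Proof.
move=> irr oT H.
suff card M : maximal_matching e M -> 2 * #|M| + 1 = #|T|.
  by move=> M1 M2 /card h1 /card h2; lia.
move=> mM; have cM := card_covered mM.1.
have := cardsC (covered M); rewrite cM.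
case: (leqP 3 #|~: covered M|) => [/(H M mM.1)[x [y [xM yM exy]]]|].
  by case/negP: (maximal_matching_uncovered irr mM xM yM).
by move: oT; lia.
Qed.

(** The triple condition. Asking for two edges rather than one ensures that an edge survives among
    the three vertices when any single edge is deleted. *)
Definition two_edges e x y z :=
  [|| e x y && e x z, e x y && e y z | e x z && e y z].

Lemma two_edges_avoid e x y z u v : x != y -> x != z -> y != z -> two_edges e x y z ->
  exists p q, [/\ p \in [:: x; y; z], q \in [:: x; y; z], e p q
                & [set p; q] != [set u; v]].
Proof.
have aux p q r : p != q -> p != r -> q != r ->
    [set p; q] = [set u; v] -> [set p; r] != [set u; v].
  move=> pq pr qr <-; apply/eqP => /setP /(_ r).
  by rewrite !inE eqxx orbT (eq_sym r) (negPf pr) (eq_sym r) (negPf qr).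
move=> xy xz yz; rewrite /two_edges => /or3P[] /andP[e1 e2].
- have [h|h] := eqVneq [set x; y] [set u; v].
    by exists x, z; rewrite !inE !eqxx ?orbT; split=> //; apply: aux h.
  by exists x, y; rewrite !inE !eqxx ?orbT.
- have [h|h] := eqVneq [set x; y] [set u; v].
    exists y, z; rewrite !inE !eqxx ?orbT; split=> //; apply: (aux y x) => //.
      by rewrite eq_sym.
    by rewrite setUC.
  by exists x, y; rewrite !inE !eqxx ?orbT.
- have [h|h] := eqVneq [set x; z] [set u; v].
    exists y, z; rewrite !inE !eqxx ?orbT; split=> //.
    rewrite [[set y; z]]setUC.
    by apply: (aux z x y); rewrite // 1?eq_sym // setUC.
  by exists x, z; rewrite !inE !eqxx ?orbT.
Qed.

(** A matching of [G] minus an edge is also a matching of [G], and of the two edges among its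
    uncovered triple at least one is not the deleted edge. *)
Lemma ESE_two_edges e : irreflexive e -> odd #|T| ->
  (forall M, matching e M -> 3 <= #|~: covered M| ->
     exists x y z, [/\ uniq [:: x; y; z], {subset [:: x; y; z] <= ~: covered M}
                     & two_edges e x y z]) ->
  ESE e.
Proof.
move=> irr oT H.
have edge M u v : matching e M -> 3 <= #|~: covered M| -> exists p q,
    [/\ p \notin covered M, q \notin covered M, e p q & [set p; q] != [set u; v]].
  move=> mM /(H M mM)[x [y [z [+ sub]]]].
  rewrite /= !inE negb_or !andbT => /andP[/andP[xy xz] yz].
  move=> /(two_edges_avoid u v xy xz yz)[p [q [ps qs epq pq]]].
  by exists p, q; split=> //; rewrite -in_setC sub.
split=> [|u v euv].
  apply: equimatchable_odd => // M mM h.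
  (* Any pair can be given to [edge] here; a vertex to form one exists because [#|T|] is odd. *)
  case: (pickP T) => [u _|T0]; last by move: oT; rewrite (eq_card0 T0).
  by have [p [q [pM qM epq _]]] := edge M u u mM h; exists p, q.
apply: equimatchable_odd => // [x|M mM h]; first by rewrite /del_edge irr.
have mM' : matching e M by apply: sub_matching mM => f x y _ _ /andP[].
have [p [q [pM qM epq pq]]] := edge M u v mM' h.
by exists p, q; rewrite /del_edge epq pq.
Qed.

(** * Matchings encoded as involutions *)

(* A matching covering exactly the vertices outside [s], encoded as the involution
   that swaps the ends of its edges. *)
Definition pairing e s (p : T -> T) :=
  involutive p /\ forall x, if x \in s then p x = x else e x (p x).

(** The uncovered vertices form a list rather than a set, so that they can be addressed by position
    and permuted by computation. *)
Definition matched_off e s := uniq s /\ exists p, pairing e s p.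

Lemma matched_off_matching e s : symmetric e -> irreflexive e -> matched_off e s ->
  exists M, matching e M /\ covered M = ~: [set x in s].
Proof.
move=> sym irr [us [p [pK hp]]].
have ps x : (p x \in s) = (x \in s).
  have := hp x; have := hp (p x); rewrite pK.
  case: (boolP (x \in s)) => [xs _ ->|xs] //.
  by case: ifP => // _ <-; rewrite irr.
exists [set [set x; p x] | x in ~: [set x in s]]; split.
  apply/matchingP; split.
    move=> f /imsetP[x]; rewrite !inE => xs ->; exists x, (p x).
    have := hp x; rewrite (negPf xs) => ex; split=> //.
    by apply: contraTneq ex => <-; rewrite irr.
  apply/trivIsetP => f g /imsetP[x _ ->] /imsetP[y _ ->].
  apply: contraR => /pred0Pn[z /= /andP[/set2P[->|->] /set2P[h|h]]].
  - by rewrite h.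
  - by rewrite h pK setUC.
  - by rewrite -h pK setUC.
  - by rewrite (can_inj pK h).
apply/setP => x; rewrite !inE; apply/mem_covered/idP => [[f /imsetP[y]]|xs].
  by rewrite !inE => ys -> /set2P[]->; rewrite ?ps.
by exists [set x; p x]; rewrite ?setU11 //; apply: imset_f; rewrite !inE.
Qed.

Lemma matching_matched_off e M s : symmetric e -> uniq s -> matching e M ->
  covered M = ~: [set x in s] -> matched_off e s.
Proof.
move=> sym us /matchingP[hM /trivIsetP hd] cM; split=> //.
pose P x y := e x y && ([set x; y] \in M).
have uniqP x y z : P x y -> P x z -> y = z.
  move=> /andP[exy xyM] /andP[exz xzM].
  have [|/(hd _ _ xyM xzM) /pred0P /(_ x)] := eqVneq [set x; y] [set x; z]; last first.
    by rewrite /= !inE eqxx.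
  have irrM f u : f \in M -> f != [set u].
    move=> /hM[a [b [ab _ ->]]]; apply: contraNneq ab => /setP h.
    by have := h a; have := h b; rewrite !inE !eqxx !orbT => /esym/eqP-> /esym/eqP->.
  move=> /setP h; have := h y; have := h z; rewrite !inE !eqxx !orbT.
  move=> /orP[/eqP zx|/eqP->//]; move: (irrM _ x xzM); rewrite zx setUid eqxx //.
(* The default [x] makes every uncovered vertex a fixed point. *)
pose p x := odflt x [pick y | P x y].
have PC x y : P x y = P y x by rewrite /P sym setUC.
have pE x y : P x y -> p x = y.
  rewrite /p; case: pickP => [z Pxz Pxy|/(_ y)->//]; exact: uniqP Pxz Pxy.
exists p; split=> x.
  have [h|h] : (exists y, P x y) \/ (forall y, P x y = false).
    by case: (pickP (P x)) => [y Pxy|]; [left; exists y|right].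
    by case: h => y Pxy; rewrite (pE _ _ Pxy) (pE y x) // PC.
  have -> : p x = x by rewrite /p; case: pickP => // z; rewrite h.
  by rewrite /p; case: pickP => // z; rewrite h.
case: ifP => xs.
  rewrite /p; case: pickP => //= y /andP[_ xyM].
  have : x \in covered M by apply/mem_covered; exists [set x; y]; rewrite // setU11.
  by rewrite cM !inE xs.
have : x \in covered M by rewrite cM !inE xs.
case/mem_covered => f fM; have [u [v [uv euv fE]]] := hM f fM.
rewrite fE => /set2P[]->; first by rewrite (pE u v) // /P euv -fE.
by rewrite (pE v u) 1?sym // /P sym euv setUC -fE.
Qed.

Lemma matched_off_perm e s1 s2 : perm_eq s1 s2 -> matched_off e s1 -> matched_off e s2.
Proof.
move=> h [u [p [pK hp]]]; split; first by rewrite -(perm_uniq h).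
by exists p; split=> // x; rewrite -(perm_mem h); apply: hp.
Qed.

(** The edge [xy] joins the matching: the new involution swaps [x] and [y], both of which [p]
    fixed. *)
Lemma matched_off_edge e x y s : symmetric e ->
  matched_off e [:: x, y & s] -> e x y -> matched_off e s.
Proof.
move=> sym [/= /and3P[]]; rewrite inE negb_or => /andP[xy xs] ys us [p [pK hp]] exy.
split=> //; exists (fun z => if z == x then y else if z == y then x else p z).
have px : p x = x by have := hp x; rewrite inE eqxx.
have py : p y = y by have := hp y; rewrite !inE eqxx orbT.
have yx : (y == x) = false by rewrite eq_sym (negPf xy).
split=> z.
  have [->|zx] := eqVneq z x; first by rewrite yx eqxx.
  have [->|zy] := eqVneq z y; first by rewrite eqxx.
  case: eqP => [h|_]; first by rewrite -px in h; rewrite (can_inj pK h) eqxx in zx.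
  case: eqP => [h|_]; first by rewrite -py in h; rewrite (can_inj pK h) eqxx in zy.
  exact: pK.
have [->|zx] := eqVneq z x; first by rewrite (negPf xs).
have [->|zy] := eqVneq z y; first by rewrite (negPf ys) sym.
by have := hp z; rewrite !inE (negPf zx) (negPf zy).
Qed.

(** Edges inside [s'] are dropped from the matching; since [p] preserves [s'], only whole edges are
    dropped. *)
Lemma pairing_matched_off e s s' p : pairing e s p -> {subset s <= s'} -> uniq s' ->
  (forall x, x \in s' -> p x \in s') -> matched_off e s'.
Proof.
move=> [pK hp] ss us cl; split=> //; exists (fun x => if x \in s' then x else p x).
have ps x : (p x \in s') = (x \in s').
  by apply/idP/idP => [/cl|/cl //]; rewrite pK.
split=> x.
  by case: (boolP (x \in s')) => [->//|xs]; rewrite ps (negPf xs) pK.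
case: (boolP (x \in s')) => // xs; have := hp x.
by case: ifP => // /ss; rewrite (negPf xs).
Qed.

(** * Counting matching edges against an independent set *)

Definition independent e S := forall x y, x \in S -> y \in S -> ~~ e x y.

(** An edge meets an independent set in one vertex or in none. Edges of the first kind correspond to
    the covered vertices of [S], those of the second kind lie in the complement. *)
Lemma card_matching_split e M S : matching e M -> independent e S ->
  #|M| = #|S :&: covered M| + #|[set f in M | f \subset ~: S]|.
Proof.
move=> /matchingP[hM dM] ind.
(* Double counting of incidences: each covered vertex of [S] lies in exactly one edge of [M]. *)
have -> : #|S :&: covered M| = \sum_(f in M) #|S :&: f|.
  rewrite -sum1_card.
  under [RHS]eq_bigr => f _ do rewrite -sum1_card big_mkcond /=.
  rewrite [RHS]exchange_big /= [LHS]big_mkcond /=; apply: eq_bigr => x _.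
  rewrite inE; have [xS|xS] := boolP (x \in S); last first.
    by rewrite big1 // => f _; rewrite inE (negPf xS).
  case: (boolP (x \in covered M)) => [/mem_covered[f fM xf]|xM]; last first.
    rewrite big1 // => f fM; rewrite inE xS /=; case: ifP => // xf.
    by case/negP: xM; apply/mem_covered; exists f.
  rewrite (bigD1 f) //= inE xS xf big1 // => g /andP[gM gf].
  rewrite inE xS /=; case: ifP => // xg.
  by have /pred0P /(_ x) := trivIsetP dM g f gM fM gf; rewrite /= xg xf.
have -> : #|[set f in M | f \subset ~: S]| = \sum_(f in M) (f \subset ~: S).
  rewrite -sum1_card big_mkcond [RHS]big_mkcond /=; apply: eq_bigr => f _.
  by rewrite inE; case: (f \in M); case: (f \subset _).
rewrite -big_split -sum1_card; apply: eq_bigr => f /hM[x [y [xy exy ->]]] /=.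
rewrite subUset !sub1set !inE.
have [xS|xS] := boolP (x \in S); have [yS|yS] /= := boolP (y \in S).
- by have := ind x y xS yS; rewrite exy.
- suff -> : S :&: [set x; y] = [set x] by rewrite cards1.
  apply/setP => z; rewrite !inE; have [->|zx] := eqVneq z x; first by rewrite xS.
  by have [->|] := eqVneq z y; rewrite ?andbF // (negPf yS).
- suff -> : S :&: [set x; y] = [set y] by rewrite cards1.
  apply/setP => z; rewrite !inE; have [->|zx] := eqVneq z y; first by rewrite yS orbT.
  by have [->|] := eqVneq z x; rewrite ?andbF // (negPf xS).
- suff -> : S :&: [set x; y] = set0 by rewrite cards0.
  apply/setP => z; rewrite !inE; have [->|zx] := eqVneq z x; first by rewrite (negPf xS).
  by have [->|] := eqVneq z y; rewrite ?andbF // (negPf yS).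
Qed.

Lemma card_matching_inside e M A : matching e M ->
  #|[set f in M | f \subset A]| <= nu (induce e A).
Proof.
move=> /matchingP[hM dM]; apply: leq_bigmax_cond; apply/matchingP; split.
  move=> f; rewrite inE => /andP[/hM[x [y [xy exy ->]]]].
  rewrite subUset !sub1set => /andP[xA yA].
  by exists x, y; rewrite /induce xy exy xA yA.
by apply: trivIsetS dM; apply/subsetP => f; rewrite inE => /andP[].
Qed.

Lemma nu_eq1 e A x y : x \in A -> y \in A -> x != y -> e x y ->
  (forall a b c d, a \in A -> b \in A -> c \in A -> d \in A ->
     [&& a != c, a != d, b != c & b != d] -> e a b -> e c d -> False) ->
  nu (induce e A) = 1.
Proof.
move=> xA yA xy exy H; apply/eqP; rewrite eqn_leq; apply/andP; split.
  apply/bigmax_leqP => M /matchingP[hM /trivIsetP dM].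
  rewrite leqNgt; apply/negP => /card_gt1P[f [g [fM gM fg]]].
  have /pred0P dfg := dM f g fM gM fg.
  have [a [b [ab /and3P[eab aA bA] fE]]] := hM f fM.
  have [c [d [cd /and3P[ecd cA dA] gE]]] := hM g gM.
  apply: (H a b c d) => //.
  have := dfg a; have := dfg b; rewrite fE gE /= !inE !eqxx !orbT /=.
  by move=> /negbT/norP[-> ->] /negbT/norP[-> ->].
apply: leq_trans (leq_bigmax_cond [set [set x; y]] _); first by rewrite cards1.
apply/matchingP; split.
  by move=> f /set1P->; exists x, y; rewrite /induce xy exy xA yA.
by apply/trivIsetP => f g /set1P-> /set1P->; rewrite eqxx.
Qed.

(** * Consequences of factor-criticality *)

Lemma factor_critical_matching e v : factor_critical e ->
  exists M, [/\ matching e M, covered M = ~: [set v] & 2 * #|M| + 1 = #|T|].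
Proof.
move=> /(_ v)[M [mM cM]]; exists M.
have mM' : matching e M by apply: sub_matching mM => f x y _ _ /and3P[].
split=> //; rewrite -(card_covered mM') cM cardsC1.
by rewrite addn1 prednK //; apply/card_gt0P; exists v.
Qed.

Lemma factor_critical_matched_off e v : symmetric e -> factor_critical e ->
  matched_off e [:: v].
Proof.
move=> sym /(factor_critical_matching v)[M [mM cM _]].
by apply: matching_matched_off mM _; rewrite // cM; apply/setP => x; rewrite !inE.
Qed.

Lemma factor_critical_odd e : 0 < #|T| -> factor_critical e -> odd #|T|.
Proof.
by move=> /card_gt0P[v _] /(factor_critical_matching v)[M [_ _ h]]; lia.
Qed.

(** The near-perfect matching that misses [v] covers all of [S], using a different edge for each
    vertex of [S]. *)
Lemma factor_critical_indep e S v : factor_critical e -> independent e S ->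
  v \notin S -> 2 * #|S| + 1 <= #|T|.
Proof.
move=> /(factor_critical_matching v)[M [mM cM cT]] ind vS.
have := card_matching_split mM ind; rewrite (setIidPl _); first by lia.
by rewrite cM; apply/subsetP => x xS; rewrite !inE; apply: contraNneq vS => <-.
Qed.

(** The lower bound on [#|T|] comes from a vertex outside [S]. For the upper bound, the near-perfect
    matching missing [v] covers the other [#|S| - 1] vertices of [S] and has at most one edge
    outside [S]. *)
Lemma in_G2_card e S v : factor_critical e -> independent e S -> v \in S ->
  nu (induce e (~: S)) = 1 -> #|T| = 2 * #|S| + 1.
Proof.
move=> fc ind vS nu1.
have [u uS] : exists u, u \notin S.
  apply/existsP; apply: contraT; rewrite negb_exists => /forallP h; exfalso.
  suff : nu (induce e (~: S)) <= 0 by rewrite nu1.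
  apply/bigmax_leqP => M /matchingP[hM _]; rewrite leqn0 cards_eq0.
  apply/eqP/setP => f; rewrite inE; apply/negP => /hM[x [y [_ /and3P[_ + _] _]]].
  by rewrite inE => xS; have := h x; rewrite xS.
have := factor_critical_indep fc ind uS.
have [M [mM cM cT]] := factor_critical_matching v fc.
have := card_matching_split mM ind; have := card_matching_inside (~: S) mM.
rewrite nu1 cM -setDE.
have := cardsD1 v S; rewrite vS; lia.
Qed.

(** The matching edge at [z] is released, and [y] is its other end. *)
Lemma matched_off_extend e s z : irreflexive e -> matched_off e s -> z \notin s ->
  exists2 y, e z y & matched_off e [:: z, y & s].
Proof.
move=> irr [us [p pp]] zs; have [pK hp] := pp.
have ez : e z (p z) by have := hp z; rewrite (negPf zs).
have ps x : x \in s -> p x = x by have := hp x; case: ifP.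
exists (p z) => //; apply: (pairing_matched_off pp) => [x xs||x].
- by rewrite !inE xs !orbT.
- rewrite /= us andbT inE negb_or zs andbT; apply/andP; split.
    by apply: contraTneq ez => <-; rewrite irr.
  by apply: contra zs => pzs; rewrite -[z]pK ps.
rewrite !inE => /or3P[/eqP->|/eqP->|xs].
- by rewrite eqxx orbT.
- by rewrite pK eqxx.
- by rewrite ps // xs !orbT.
Qed.

(** * The triple condition on a list of uncovered vertices, by index *)

Section Indexed.
Variables (e : rel T) (sym : symmetric e) (x0 : T) (L : seq T).
Hypothesis mL : matched_off e L.
Hypothesis two : forall x y z, matched_off e [:: x; y; z] -> two_edges e x y z.
Let g := nth x0 L.

(** The index lists used below are literals, so the permutation hypothesis is settled by
    evaluation. *)
Lemma matched_off_idx i : perm_eq i (iota 0 (size L)) -> matched_off e (map g i).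
Proof.
move=> h; apply: matched_off_perm mL; rewrite perm_sym.
rewrite -[X in perm_eq _ X](mkseq_nth x0); exact: perm_map.
Qed.

(* In these lemmas the first index pairs are edges added to the matching; the last three
   indices are what remains uncovered. *)
Lemma two_edges5 i j a b c : perm_eq [:: i; j; a; b; c] (iota 0 (size L)) ->
  e (g i) (g j) -> two_edges e (g a) (g b) (g c).
Proof. by move=> /matched_off_idx /(matched_off_edge sym) + h => /(_ h) /two. Qed.

Lemma two_edges7 i j k l a b c : perm_eq [:: i; j; k; l; a; b; c] (iota 0 (size L)) ->
  e (g i) (g j) -> e (g k) (g l) -> two_edges e (g a) (g b) (g c).
Proof.
move=> /matched_off_idx /(matched_off_edge sym) + h1 h2.
by move=> /(_ h1) /(matched_off_edge sym) /(_ h2) /two.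
Qed.

Lemma two_edges9 i j k l m n a b c :
  perm_eq [:: i; j; k; l; m; n; a; b; c] (iota 0 (size L)) ->
  e (g i) (g j) -> e (g k) (g l) -> e (g m) (g n) -> two_edges e (g a) (g b) (g c).
Proof.
move=> /matched_off_idx /(matched_off_edge sym) + h1 h2 h3.
by move=> /(_ h1) /(matched_off_edge sym) /(_ h2) /(matched_off_edge sym) /(_ h3) /two.
Qed.

End Indexed.

(** * The triple condition on seven and nine vertices *)
Section Local.
Variables (e : rel T) (sym : symmetric e).
Hypothesis two : forall x y z, matched_off e [:: x; y; z] -> two_edges e x y z.

(** An induced complete bipartite graph with sides [v], [a], [b] and [a'], [b']. *)
Definition K32 v a b a' b' :=
  [&& e v a', e v b', e a a', e a b', e b a' & e b b'] &&
  [&& ~~ e v a, ~~ e v b, ~~ e a b & ~~ e a' b'].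

(** Every step adds two known edges to the matching and reads the triple condition on the three
    vertices left over; a known non-edge among them forces the two other pairs to be edges. *)
Lemma K32_edge_last v a b a' b' x y : matched_off e [:: v; a; b; a'; b'; x; y] ->
  K32 v a b a' b' -> e x y -> ~~ e b y ->
  [&& e v x, e a x, e b x, e a' y, e b' y, ~~ e a' x & ~~ e b' x].
Proof.
move=> mL /andP[/and3P[va' vb' /and4P[aa' ab' ba' bb']]].
move=> /and4P[/negPf va /negPf vb /negPf ab /negPf ab2] xy /negPf bny.
(* Indices 0 to 6 stand for [v], [a], [b], [a'], [b'], [x], [y]. *)
have k := @two_edges7 e sym v _ mL two.
have bx : e b x.
  by have /= := k 0 3 1 4 2 5 6 isT va' ab'; rewrite /two_edges bny xy; case: (e b x).
(* Otherwise [vy] and then [a'x] are forced, and adding [a'x] and [vb'] leaves [a], [b], [y], where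
   [b] is isolated. *)
have vax : e v x || e a x.
  rewrite -[_ || _]negbK negb_or; apply/negP => /andP[/negPf vx /negPf ax].
  have vy : e v y.
    by have /= := k 1 3 2 4 0 5 6 isT aa' bb'; rewrite /two_edges vx; case: (e v y).
  have ax' : e a' x.
    by have /= := k 0 6 2 4 1 3 5 isT vy bb'; rewrite /two_edges ax aa'; case: (e a' x).
  by have /= := k 3 5 0 4 1 2 6 isT ax' vb'; rewrite /two_edges ab bny !andbF.
have [ya yb] : e a' y /\ e b' y.
  case/orP: vax => [vx|ax].
    have /= := k 0 5 1 4 2 3 6 isT vx ab'; have /= := k 0 5 1 3 2 4 6 isT vx aa'.
    by rewrite /two_edges bny ba' bb' !andbF !orbF.
  have /= := k 1 5 0 4 2 3 6 isT ax vb'; have /= := k 1 5 0 3 2 4 6 isT ax va'.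
  by rewrite /two_edges bny ba' bb' !andbF !orbF.
have [vx ax] : e v x /\ e a x.
  by have /= := k 3 6 2 4 0 1 5 isT ya bb'; rewrite /two_edges va => /andP.
(* If [x] saw [a'] or [b'], matching it there and [y] to the other one would leave the independent
   triple [v], [a], [b]. *)
rewrite vx ax bx ya yb /=; apply/andP; split; apply/negP => h.
  by have /= := k 3 5 4 6 0 1 2 isT h yb; rewrite /two_edges va vb ab.
by have /= := k 4 5 3 6 0 1 2 isT h ya; rewrite /two_edges va vb ab.
Qed.

(** The roles of [v], [a], [b] are symmetric, so the non-neighbour of [y] can be moved to the third
    place. *)
Lemma K32_edge v a b a' b' x y : matched_off e [:: v; a; b; a'; b'; x; y] ->
  K32 v a b a' b' -> e x y -> ~~ [&& e v y, e a y & e b y] ->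
  [&& e v x, e a x, e b x, e a' y, e b' y, ~~ e a' x & ~~ e b' x].
Proof.
move=> mL kL xy; rewrite !negb_and => /or3P[] nb; last exact: K32_edge_last nb.
- have := K32_edge_last (matched_off_idx v mL (i:=[:: 1; 2; 0; 3; 4; 5; 6]) isT) _ xy nb.
  case/andP: kL => /and3P[va' vb' /and4P[aa' ab' ba' bb']].
  move=> /and4P[va vb ab a'b']; rewrite /K32 ![e _ v]sym.
  rewrite va' vb' aa' ab' ba' bb' va vb ab a'b' => /(_ isT).
  by case: (e v x) => //; rewrite ?andbF.
- have := K32_edge_last (matched_off_idx v mL (i:=[:: 0; 2; 1; 3; 4; 5; 6]) isT) _ xy nb.
  case/andP: kL => /and3P[va' vb' /and4P[aa' ab' ba' bb']].
  move=> /and4P[va vb ab a'b']; rewrite /K32 [e b a]sym.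
  rewrite va' vb' aa' ab' ba' bb' va vb ab a'b' => /(_ isT).
  by case: (e a x) => //; rewrite ?andbF.
Qed.

(** [type1] and [type2] are local forms of the two types of outer edges, tested on three vertices of
    the independent set. In [type2] the vertex [x] behaves like a third vertex on the side of [a'],
    [b']. *)
Definition type1 v a b x y :=
  [&& e v x, e a x & e b x] && [&& e v y, e a y & e b y].

Definition type2 v a b a' b' x y :=
  [&& e v x, e a x, e b x, ~~ e a' x & ~~ e b' x] && (e a' y && e b' y).

(** Matching [v], [a], [b] into [y], [z], [w] leaves [a'], [b'], [x], so [x] sees both [a'] and
    [b']; likewise [y]. Then [a'x], [b'y], [zw] leave the independent triple [v], [a], [b]. *)
Lemma type1_type1 v a b a' b' x y z w :
  matched_off e [:: v; a; b; a'; b'; x; y; z; w] -> K32 v a b a' b' ->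
  e x y -> e z w -> type1 v a b x y -> ~~ type1 v a b z w.
Proof.
move=> mL /andP[_ /and4P[/negPf va /negPf vb /negPf ab /negPf a'b']] xy zw.
move=> /andP[/and3P[vx ax bx] /and3P[vy ay bY]].
apply/negP => /andP[/and3P[vz az bz] /and3P[vw aw bw]].
have k := @two_edges9 e sym v _ mL two.
have /= := k 0 6 1 7 2 8 3 4 5 isT vy az bw.
have /= := k 0 5 1 7 2 8 3 4 6 isT vx az bw.
rewrite /two_edges a'b' /= => /andP[a'y b'y] /andP[a'x b'x].
have /= := k 3 5 4 6 7 8 0 1 2 isT a'x b'y zw.
by rewrite /two_edges va vb ab.
Qed.

(** If [w] had a neighbour among [v], [a], [b], these three could be matched into [w], [x], [y],
    leaving the independent triple [a'], [b'], [z]. *)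
Lemma type1_type2 v a b a' b' x y z w :
  matched_off e [:: v; a; b; a'; b'; x; y; z; w] -> K32 v a b a' b' ->
  type1 v a b x y -> type2 v a b a' b' z w -> ~~ [|| e v w, e a w | e b w].
Proof.
move=> mL /andP[_ /and4P[_ _ _ /negPf a'b']].
move=> /andP[/and3P[vx ax bx] /and3P[vy ay bY]].
move=> /andP[/and5P[_ _ _ /negPf a'z /negPf b'z] _].
have k := @two_edges9 e sym v _ mL two.
have no : ~~ two_edges e a' b' z by rewrite /two_edges a'b' a'z b'z.
apply: contra no => /or3P[] h.
- exact: (k 0 8 1 5 2 6 3 4 7 isT h ax bY).
- exact: (k 0 5 1 8 2 6 3 4 7 isT vx h bY).
- exact: (k 0 5 1 6 2 8 3 4 7 isT vx ay h).
Qed.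

Lemma type2_type2 v a b a' b' x y z w :
  matched_off e [:: v; a; b; a'; b'; x; y; z; w] -> K32 v a b a' b' ->
  type2 v a b a' b' x y -> type2 v a b a' b' z w ->
  [|| e v y, e a y | e b y] -> [|| e v w, e a w | e b w] -> ~~ e x z.
Proof.
move=> mL /andP[/and3P[va' _ /and4P[aa' _ ba' _]] /and4P[/negPf va /negPf vb /negPf ab /negPf a'b']].
move=> /andP[/and5P[vx ax bx /negPf a'x /negPf b'x] /andP[a'y b'y]].
move=> /andP[/and5P[vz az bz /negPf a'z /negPf b'z] /andP[a'w b'w]] hy hw.
apply/negP => xz.
have k := @two_edges9 e sym v _ mL two.
have no : two_edges e a' b' x = false by rewrite /two_edges a'b' a'x b'x.
(* If [y] and [w] had distinct neighbours among [v], [a], [b], matching the third vertex to [z]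
   would leave the independent triple [a'], [b'], [x]. *)
have h1 : e v y -> e a w -> False.
  by move=> h h'; have := k 0 6 1 8 2 7 3 4 5 isT h h' bz; rewrite /= no.
have h2 : e v y -> e b w -> False.
  by move=> h h'; have := k 0 6 2 8 1 7 3 4 5 isT h h' az; rewrite /= no.
have h3 : e a y -> e v w -> False.
  by move=> h h'; have := k 1 6 0 8 2 7 3 4 5 isT h h' bz; rewrite /= no.
have h4 : e a y -> e b w -> False.
  by move=> h h'; have := k 1 6 2 8 0 7 3 4 5 isT h h' vz; rewrite /= no.
have h5 : e b y -> e v w -> False.
  by move=> h h'; have := k 2 6 0 8 1 7 3 4 5 isT h h' az; rewrite /= no.
have h6 : e b y -> e a w -> False.
  by move=> h h'; have := k 2 6 1 8 0 7 3 4 5 isT h h' vz; rewrite /= no.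
(* A common neighbour is excluded too: adding [xz], the edge from [b'] to [w] and one from the
   common neighbour to [a'] forces a second neighbour of [y], which reduces to the previous
   cases. *)
have l1 : e v y -> e v w -> False.
  move=> h h'; have /= := k 0 3 4 8 5 7 1 2 6 isT va' b'w xz.
  by rewrite /two_edges ab /= => /andP[ay _]; exact: h3 ay h'.
have l2 : e a y -> e a w -> False.
  move=> h h'; have /= := k 1 3 4 8 5 7 0 2 6 isT aa' b'w xz.
  by rewrite /two_edges vb /= => /andP[vy _]; exact: h1 vy h'.
have l3 : e b y -> e b w -> False.
  move=> h h'; have /= := k 2 3 4 8 5 7 0 1 6 isT ba' b'w xz.
  by rewrite /two_edges va /= => /andP[vy _]; exact: h2 vy h'.
by case/or3P: hy => hy; case/or3P: hw => hw; eauto.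
Qed.

(* The vertices [v a' a b b'] form a five-cycle with at most the chords [a b'], [b a']. *)
Definition house v a b a' b' :=
  [&& e v a', e v b', e a b, e a a' & e b b'] &&
  [&& ~~ e v a, ~~ e v b, ~~ e a' b' & e a b' == e b a'].

(** Adding [aa'] and [bb'] shows that [v] sees an end of [xy]. If it saw only one, the triple
    condition would separate that end from [a'] and [b'], or the other end in the mirrored case;
    either way an independent triple would result. *)
Lemma house_apex v a b a' b' x y : matched_off e [:: v; a; b; a'; b'; x; y] ->
  (forall p q r, uniq [:: p; q; r] -> [|| e p q, e p r | e q r]) ->
  house v a b a' b' -> e x y -> e v x && e v y.
Proof.
move=> mL tri /andP[/and5P[va' vb' ab aa' bb'] /and4P[/negPf va /negPf vb /negPf a'b' _]] xy.
have k := @two_edges7 e sym v _ mL two.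
have [us _] := mL.
have := k 1 3 2 4 0 5 6 isT aa' bb'; rewrite /two_edges /= xy !andbT.
have [vx|vx] := boolP (e v x).
  have [//|vy] := boolP (e v y).
  have a'x : e a' x = false.
    apply/negP => h; have /= := k 3 5 2 4 0 1 6 isT h bb'.
    by rewrite /two_edges va (negPf vy).
  have b'x : e b' x = false.
    apply/negP => h; have /= := k 4 5 1 3 0 2 6 isT h aa'.
    by rewrite /two_edges vb (negPf vy).
  suff /tri : uniq [:: a'; b'; x] by rewrite a'b' a'x b'x.
  exact: (mask_uniq us [:: false; false; false; true; true; true]).
rewrite /= => vy.
have a'y : e a' y = false.
  apply/negP => h; have /= := k 3 6 2 4 0 1 5 isT h bb'.
  by rewrite /two_edges va (negPf vx).
have b'y : e b' y = false.
  apply/negP => h; have /= := k 4 6 1 3 0 2 5 isT h aa'.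
  by rewrite /two_edges vb (negPf vx).
suff /tri : uniq [:: a'; b'; y] by rewrite a'b' a'y b'y.
exact: (mask_uniq us [:: false; false; false; true; true; false; true]).
Qed.

(** Without chords the five-cycle can be turned to have apex [a]; then [vy] and [ax] leave [b],
    [a'], [b'] with the single edge [bb']. With both chords, [x] and [y] see [a'] and [b'], and
    [a'x], [b'y] leave [v], [a], [b] with the single edge [ab]. *)
Lemma house_false v a b a' b' x y : matched_off e [:: v; a; b; a'; b'; x; y] ->
  (forall p q r, uniq [:: p; q; r] -> [|| e p q, e p r | e q r]) ->
  house v a b a' b' -> e x y -> False.
Proof.
move=> mL tri hL xy; have /andP[vx vy] := house_apex mL tri hL xy.
case/andP: hL => /and5P[va' vb' ab aa' bb'].
move=> /and4P[/negPf va /negPf vb /negPf a'b' /eqP E].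
have k := @two_edges7 e sym v _ mL two.
have [ab'|ab'] := boolP (e a b'); last first.
  have h : house a v b' a' b.
    by rewrite /house aa' ab vb' va' (sym b') bb' (sym a) va ab' (sym a') -E ab' vb (sym b') a'b'.
  have mL' := matched_off_idx v mL (i:=[:: 1; 0; 4; 3; 2; 5; 6]) isT.
  have /andP[ax ay] := house_apex mL' tri h xy.
  have /= := k 0 6 1 5 2 3 4 isT vy ax.
  by rewrite /two_edges a'b' -E (negPf ab') !andbF.
have /= := k 0 5 1 2 3 4 6 isT vx ab; have /= := k 0 6 1 2 3 4 5 isT vy ab.
rewrite /two_edges a'b' /= => /andP[a'x b'x] /andP[a'y b'y].
have /= := k 3 5 4 6 0 1 2 isT a'x b'y.
by rewrite /two_edges va vb.
Qed.

End Local.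

(** * Edge-stability in terms of triples, and edge-stability of the families *)

(** Suppose [a] sees neither [b] nor [c], the three being uncovered by [M]. Once [bc] is deleted, if
    it is an edge, [M] is maximal with three uncovered vertices, while a near-perfect matching
    missing [b] is maximal with one. *)
Lemma ESE_matched_off3 e x y z : symmetric e -> irreflexive e ->
  factor_critical e -> ESE e -> matched_off e [:: x; y; z] -> two_edges e x y z.
Proof.
move=> sym irr fc [eqm eqd] mo.
have aux (a b c : T) : matched_off e [:: a; b; c] -> ~~ e a b -> ~~ e a c -> False.
  move=> m3 ab ac.
  have [M [mM cM]] := matched_off_matching sym irr m3.
  have [N [mN cN cT]] := factor_critical_matching b fc.
  have cM2 : 2 * #|M| + 3 = #|T|.
    rewrite -(card_covered mM) cM -(cardsC [set v in [:: a; b; c]]) addnC.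
    by rewrite [X in _ = X + _]cardsE (card_uniqP m3.1).
  (* Here [e'] stands for [e] itself or for [e] without [bc]. Neither [M] nor [N] uses [bc], since
     both leave [b] uncovered. *)
  have no e' : equimatchable e' -> (forall u v, e' u v -> e u v) ->
      (forall u v, e u v -> [set u; v] != [set b; c] -> e' u v) ->
      ~~ e' b c -> ~~ e' c b -> False.
    move=> eq' sub sup bc cb.
    have unc f : f \in M \/ f \in N -> f != [set b; c].
      move=> h; apply/eqP => fE.
      have : b \in f by rewrite fE setU11.
      case: h => h bf.
        have : b \in covered M by apply/mem_covered; exists f.
        by rewrite cM !inE eqxx !orbT.
      have : b \in covered N by apply/mem_covered; exists f.
      by rewrite cN !inE eqxx.
    suff : #|M| = #|N| by lia.
    apply: eq'; apply: maximal_matching_indep.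
    - by apply: sub_matching mM => f u v fM fE euv; apply: sup; rewrite // -fE unc; auto.
    - move=> u v; rewrite cM !inE !negbK.
      have irr' w : ~~ e' w w by apply: contraFN (irr w); apply: sub.
      have nab w w' : ~~ e w w' -> ~~ e' w w' /\ ~~ e' w' w.
        by move=> h; split; apply: contra h => /sub //; rewrite sym.
      by case/or3P=> /eqP-> /or3P[] /eqP-> //; case: (nab _ _ ab); case: (nab _ _ ac).
    - by apply: sub_matching mN => f u v fM fE euv; apply: sup; rewrite // -fE unc; auto.
    - move=> u v; rewrite cN !inE !negbK => /eqP-> /eqP->.
      by apply: contraFN (irr b); apply: sub.
  have [bc|bc] := boolP (e b c).
    apply: (no (del_edge e b c)); rewrite /del_edge.
    - exact: eqd.
    - by move=> u v /andP[].
    - by move=> u v -> ->.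
    - by rewrite eqxx andbF.
    - by rewrite setUC eqxx andbF.
  by apply: (no e) => //; rewrite sym.
(* With at most one edge among three vertices, one of them is adjacent to neither of the others. *)
rewrite /two_edges; apply: contraT => h.
have mo1 : matched_off e [:: y; x; z].
  by apply: matched_off_perm mo; rewrite (perm_catCA [:: x] [:: y] [:: z]).
have mo2 : matched_off e [:: z; x; y].
  by apply: matched_off_perm mo; rewrite (perm_catC [:: x; y] [:: z]).
have := aux _ _ _ mo; have := aux _ _ _ mo1; have := aux _ _ _ mo2.
rewrite (sym y x) (sym z x) (sym z y).
by move: h; case: (e x y); case: (e x z); case: (e y z) => //= _ a b c;
   first [case: (a isT isT)|case: (b isT isT)|case: (c isT isT)].
Qed.

(** When no vertex has two non-neighbours, any three vertices span two edges. This covers complete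
    graphs and G1 together. *)
Lemma complement_matching_ESE e : irreflexive e -> symmetric e -> odd #|T| ->
  (forall x y z, x != y -> x != z -> y != z -> e x y || e x z) -> ESE e.
Proof.
move=> irr sym oT H; apply: ESE_two_edges => // M mM /card_gt2P[x [y [z [[xM yM zM] [xy yz zx]]]]].
exists x, y, z; split.
- by rewrite /= !inE negb_or xy yz eq_sym zx.
- by move=> u; rewrite !inE => /or3P[] /eqP->; rewrite -in_setC.
have := H x y z xy _ yz; have := H y x z _ yz _; have := H z x y zx _ xy.
rewrite (eq_sym y) xy (eq_sym x z) zx (eq_sym z) yz (sym y x) (sym z x) (sym z y).
rewrite /two_edges; case: (e x y); case: (e x z); case: (e y z) => //= h1 h2 h3.
all: by [case: (h1 isT)|case: (h2 isT isT)|case: (h3 isT)].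
Qed.

(** If uncovered vertices exist both in [S] and outside it, the complete join gives two edges in a
    triple containing one of each. Otherwise either [S] is covered or only vertices of [S] are
    uncovered, and counting with [#|T| = 2 * #|S| + 1] leaves at most one uncovered vertex. *)
Lemma in_G2_ESE e : irreflexive e -> symmetric e -> factor_critical e -> in_G2 e -> ESE e.
Proof.
move=> irr sym fc [S [ind S3 full nu1]].
have [v vS] : exists v, v \in S by apply/card_gt0P; lia.
have cT := in_G2_card fc ind vS nu1.
apply: ESE_two_edges => // [|M mM U3]; first by lia.
have := card_matching_split mM ind; have := card_matching_inside (~: S) mM.
rewrite nu1; have := card_covered mM; have := cardsC (covered M).
have [|nS] := boolP [exists x in S, x \notin covered M]; last first.
  have -> : S :&: covered M = S.
    apply/setIidPl/subsetP => x xS; move/exists_inPn: nS => /(_ x xS).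
    by rewrite negbK.
  by lia.
case/exists_inP => x xS xM.
have [|nC] := boolP [exists y in ~: S, y \notin covered M]; last first.
  have : ~: covered M \subset S.
    apply/subsetP => y; rewrite inE => yM; apply: contraT => yS.
    by move/exists_inPn: nC => /(_ y); rewrite inE yS yM => /(_ isT).
  move=> /setIidPr US; have := cardsID (covered M) S; rewrite setDE US.
  by lia.
case/exists_inP => y; rewrite inE => yS yM _ _ _ _.
have xy : x != y by apply: contraNneq yS => <-.
have [z zM] : exists2 z, z \in ~: covered M & z \notin [:: x; y].
  apply/exists_inP; rewrite -negb_forall_in; apply/negP => /forall_inP h.
  have : ~: covered M \subset [set x; y].
    by apply/subsetP => z /h; rewrite !inE.
  by move/subset_leq_card; rewrite cards2 xy; lia.
rewrite !inE negb_or => /andP[zx zy].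
exists x, y, z; split.
- by rewrite /= !inE negb_or xy eq_sym zx eq_sym zy.
- by move=> u; rewrite !inE => /or3P[] /eqP-> //; rewrite -in_setC.
rewrite /two_edges full //; case: (boolP (z \in S)) => zS.
  by rewrite (sym y) (full z y zS yS) orbT.
by rewrite (full x z xS zS).
Qed.
Lemma exists_notin (S : {set T}) s : size s < #|S| -> exists2 c, c \in S & c \notin s.
Proof.
move=> h; apply/exists_inP; rewrite -negb_forall_in; apply/negP => /forall_inP sub.
have : S \subset [set x in s] by apply/subsetP => x /sub; rewrite inE.
move/subset_leq_card; have : #|[set x in s]| <= size s by rewrite cardsE card_size.
by lia.
Qed.

(** * Structure around a maximum independent set *)
Section Structure.
Variables (e : rel T) (sym : symmetric e) (irr : irreflexive e).
Hypothesis fc : factor_critical e.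
Hypothesis two : forall x y z, matched_off e [:: x; y; z] -> two_edges e x y z.
Variables (S : {set T}) (v : T) (p : T -> T).
Hypotheses (indS : independent e S) (S3 : 3 <= #|S|) (vS : v \in S).
Hypothesis maxS : forall S', independent e S' -> #|S'| <= #|S|.
Hypothesis pp : pairing e [:: v] p.

Let pK : involutive p := pp.1.

Let pv : p v = v.
Proof. by have := pp.2 v; rewrite inE eqxx. Qed.

Let pe x : x != v -> e x (p x).
Proof. by have := pp.2 x; rewrite inE => + /negPf xv; rewrite xv. Qed.

Let pS a : a \in S -> a != v -> p a \notin S.
Proof. by move=> aS /pe; apply: contraL; apply: indS. Qed.

(** As [p] fixes [v], this is the complement of the union of [S] and [p (S \ v)]. *)
Let R := [set x | (x \notin S) && (p x \notin S)].

Let Rp x : x \in R -> p x \in R.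
Proof. by rewrite !inE pK andbC. Qed.

Let Rv x : x \in R -> x != v.
Proof. by rewrite inE => /andP[xS _]; apply: contraNneq xS => ->. Qed.

Let Re x : x \in R -> e x (p x).
Proof. by move/Rv/pe. Qed.

(** Chosen vertices are released from the matching together with their partners. Partners of
    vertices of [S] other than [v] lie outside [S], and [R] is closed under [p], so no vertex is
    repeated. *)
Lemma frame s1 s2 : {subset s1 <= S} -> {subset s2 <= R} -> uniq (v :: s1) -> uniq s2 ->
  (forall x y, x \in s2 -> y \in s2 -> x != p y) ->
  matched_off e (v :: (s1 ++ s2) ++ map p (s1 ++ s2)).
Proof.
move=> h1 h2 /= /andP[vs1 u1] u2 h.
have u12 : uniq (s1 ++ s2).
  rewrite cat_uniq u1 u2 andbT /=; apply/hasPn => x /h2; rewrite inE => /andP[xS _].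
  by apply: contra xS; apply: h1.
have vs : v \notin s1 ++ s2.
  by rewrite mem_cat negb_or vs1 /=; apply/negP => /h2 /Rv; rewrite eqxx.
apply: (pairing_matched_off pp) => [x||x].
- by rewrite !inE => ->.
- rewrite /= mem_cat negb_or vs /=; apply/andP; split.
    by rewrite -[X in X \notin _]pv (mem_map (can_inj pK)).
  rewrite cat_uniq u12 (map_inj_uniq (can_inj pK)) u12 andbT /=.
  apply/hasPn => y /mapP[x + ->]; rewrite !mem_cat => /orP[xs|xs]; apply/negP => /orP[ys|ys].
  - have xv : x != v by apply: contraNneq vs1 => <-.
    by have := pS (h1 x xs) xv; rewrite h1.
  - by have := h2 _ ys; rewrite inE pK (h1 x xs) andbF.
  - by have := h2 _ xs; rewrite inE (h1 _ ys) andbF.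
  - by have := h _ _ ys xs; rewrite eqxx.
rewrite !inE !mem_cat => /or3P[/eqP->|xs|/mapP[y ys ->]].
- by rewrite pv eqxx.
- by rewrite map_f ?orbT // mem_cat.
- by rewrite pK -mem_cat ys !orbT.
Qed.

Let sub2 (A : {set T}) c d : c \in A -> d \in A -> {subset [:: c; d] <= A}.
Proof. by move=> cA dA z; rewrite !inE => /orP[]/eqP->. Qed.

Lemma frame5 c d : c \in S -> d \in S -> uniq [:: v; c; d] ->
  matched_off e [:: v; c; d; p c; p d].
Proof. by move=> cS dS u; apply: (@frame [:: c; d] [::]) => //; apply: sub2. Qed.

Lemma frame7 c d x : c \in S -> d \in S -> uniq [:: v; c; d] -> x \in R ->
  matched_off e [:: v; c; d; p c; p d; x; p x].
Proof.
move=> cS dS u xR.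
suff f : matched_off e [:: v; c; d; x; p c; p d; p x].
  exact: (matched_off_idx v f (i := [:: 0; 1; 2; 4; 5; 3; 6]) isT).
apply: (@frame [:: c; d] [:: x] (sub2 cS dS) _ u isT _).
  by move=> z; rewrite mem_seq1 => /eqP->.
move=> y z /[!inE] /eqP-> /eqP->; apply: contraTneq (Re xR) => <-.
by rewrite irr.
Qed.

Lemma frame9 c d x z : c \in S -> d \in S -> uniq [:: v; c; d] -> x \in R -> z \in R ->
  z != x -> z != p x -> matched_off e [:: v; c; d; p c; p d; x; p x; z; p z].
Proof.
move=> cS dS u xR zR zx zpx.
suff f : matched_off e [:: v; c; d; x; z; p c; p d; p x; p z].
  exact: (matched_off_idx v f (i := [:: 0; 1; 2; 5; 6; 3; 7; 4; 8]) isT).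
apply: (@frame [:: c; d] [:: x; z] (sub2 cS dS) (sub2 xR zR) u).
  by rewrite /= inE eq_sym zx.
have nfix y : y \in R -> y != p y by move=> /Re; apply: contraTneq => <-; rewrite irr.
move=> y w /[!inE] /orP[]/eqP-> /orP[]/eqP->; rewrite ?nfix //.
by apply: contraNneq zpx => ->; rewrite pK.
Qed.

(** An edge between [p c] and [p d] would leave the independent triple [v], [c], [d]. The cross
    edges follow by adding one known edge to the matching and reading the remaining triple. *)
Lemma frame_K32 c d : c \in S -> d \in S -> uniq [:: v; c; d] -> K32 e v c d (p c) (p d).
Proof.
move=> cS dS u; have f := frame5 cS dS u.
have := u; rewrite /= !inE negb_or andbT => /andP[/andP[vc vd] cd].
have k := @two_edges5 e sym v _ f two.
have cc : e c (p c) by apply: pe; rewrite eq_sym.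
have dd : e d (p d) by apply: pe; rewrite eq_sym.
have [nvc nvd ncd] : [/\ e v c = false, e v d = false & e c d = false].
  by split; apply/negbTE/indS.
have cd' : ~~ e (p c) (p d).
  by apply/negP => h; have /= := k 3 4 0 1 2 isT h; rewrite /two_edges nvc nvd ncd.
have vc' : e v (p c) by have /= := k 2 4 0 1 3 isT dd; rewrite /two_edges nvc; case: (e v _).
have vd' : e v (p d) by have /= := k 1 3 0 2 4 isT cc; rewrite /two_edges nvd; case: (e v _).
have c_d' : e c (p d) by have /= := k 0 3 1 2 4 isT vc'; rewrite /two_edges ncd; case: (e c _).
have d_c' : e d (p c).
  by have /= := k 0 4 1 2 3 isT vd'; rewrite /two_edges ncd; case: (e d _); rewrite ?andbF.
by rewrite /K32 cc dd cd' vc' vd' c_d' d_c' nvc nvd ncd.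
Qed.

(** Any two vertices of [S] fit in a common frame with [v]; this carries statements about frames
    over to the whole of [S]. *)
Lemma pick_frame (s t : T) : s \in S -> t \in S ->
  exists c d, [/\ c \in S, d \in S, uniq [:: v; c; d], s \in [:: v; c; d] & t \in [:: v; c; d]].
Proof.
move=> sS tS.
have [c [cS cv sc]] : exists c, [/\ c \in S, c != v & s \in [:: v; c]].
  have [->|sv] := eqVneq s v; last by exists s; rewrite !inE eqxx orbT.
  have [|c cS] := @exists_notin S [:: v]; first by apply: leq_trans S3.
  by rewrite inE => cv; exists c; rewrite !inE eqxx.
have [d [dS dvc td]] : exists d, [/\ d \in S, d \notin [:: v; c] & t \in [:: v; c; d]].
  have [tc|tc] := boolP (t \in [:: v; c]); last first.
    by exists t; split; rewrite // !inE eqxx !orbT.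
  have [d dS dvc] := @exists_notin S [:: v; c] S3.
  by exists d; split=> //; move: tc; rewrite !inE orbA => ->.
exists c, d; split=> //.
  move: dvc; rewrite !inE negb_or => /andP[dv dc].
  by rewrite /= !inE negb_or eq_sym cv eq_sym dv eq_sym dc.
by move: sc; rewrite !inE orbA => ->.
Qed.

Lemma full_S' a c : a \in S -> c \in S -> c != v -> e a (p c).
Proof.
move=> aS cS cv; have [c1 [d1 [c1S d1S u]]] := pick_frame aS cS.
have /andP[/and3P[h1 h2 /and4P[h3 h4 h5 h6]] _] := frame_K32 c1S d1S u.
by rewrite !inE (negPf cv) /= => /or3P[] /eqP-> /orP[] /eqP->.
Qed.

Lemma indep_S' a c : a \in S -> c \in S -> a != v -> c != v -> ~~ e (p a) (p c).
Proof.
move=> aS cS av cv; have [->|ac] := eqVneq a c; first by rewrite irr.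
suff /(frame_K32 aS cS)/andP[_ /and4P[]] : uniq [:: v; a; c] by [].
by rewrite /= !inE negb_or eq_sym av eq_sym cv ac.
Qed.

Lemma max_adj y : y \notin S -> exists2 t, t \in S & e t y.
Proof.
move=> yS; apply/exists_inP; apply: contraT.
rewrite negb_exists_in => /forall_inP h.
have /maxS : independent e (y |: S).
  move=> a b /setU1P[->|aS] /setU1P[->|bS]; rewrite ?irr ?h //.
  - by rewrite sym h.
  - exact: indS.
by rewrite cardsU1 yS; lia.
Qed.

(* The two types of matching edges [{x, p x}] outside [S] and [p (S \ v)]. *)
Let T1 x := forall a, a \in S -> e a x && e a (p x).

Let T2 x := (forall a, a \in S -> e a x) /\
  (forall a, a \in S -> a != v -> e (p a) (p x) && ~~ e (p a) x).

Lemma edge_types x : x \in R -> T1 x \/ T2 x \/ T2 (p x).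
Proof.
move=> xR.
(* One vertex [b] of [S] not adjacent to [p y] settles the type: every other vertex of [S] shares a
   frame with [b], and [K32_edge] applies there. *)
have aux y b : y \in R -> b \in S -> ~~ e b (p y) -> T2 y.
  move=> yR bS nb.
  have loc c d : c \in S -> d \in S -> uniq [:: v; c; d] -> b \in [:: v; c; d] ->
      [&& e v y, e c y, e d y, e (p c) (p y), e (p d) (p y), ~~ e (p c) y & ~~ e (p d) y].
    move=> cS dS u bvcd.
    apply: (K32_edge sym two (frame7 cS dS u yR) (frame_K32 cS dS u) (Re yR)).
    by move: bvcd nb; rewrite !inE => /or3P[] /eqP->; apply: contra => /and3P[].
  split=> a aS.
    have [c [d [cS dS u bvcd]]] := pick_frame bS aS.
    have /and4P[h1 h2 h3 _] := loc c d cS dS u bvcd.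
    by rewrite !inE => /or3P[] /eqP->.
  move=> av; have [c [d [cS dS u bvcd]]] := pick_frame bS aS.
  have /and5P[_ _ _ h1 /and3P[h2 h3 h4]] := loc c d cS dS u bvcd.
  by rewrite !inE (negPf av) /= => /orP[] /eqP->; apply/andP.
have [/forall_inP|/forall_inPn[b bS]] := boolP [forall a in S, e a x && e a (p x)].
  by left.
rewrite negb_and => /orP[] nb; right; [right|left]; last exact: aux nb.
by apply: (aux _ b); rewrite ?Rp ?pK.
Qed.

Lemma T1_T1_false x z : x \in R -> z \in R -> z != x -> z != p x -> T1 x -> T1 z -> False.
Proof.
move=> xR zR zx zpx t1 t2; have [c [d [cS dS u _ _]]] := pick_frame vS vS.
have := type1_type1 sym two (frame9 cS dS u xR zR zx zpx) (frame_K32 cS dS u) (Re xR) (Re zR).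
rewrite /type1; have /andP[-> ->] := t1 _ vS; have /andP[-> ->] := t2 _ vS.
have /andP[-> ->] := t1 _ cS; have /andP[-> ->] := t2 _ cS.
by have /andP[-> ->] := t1 _ dS; have /andP[-> ->] := t2 _ dS => /(_ isT).
Qed.

Lemma frame_type2 c d x : c \in S -> d \in S -> uniq [:: v; c; d] -> T2 x ->
  type2 e v c d (p c) (p d) x (p x).
Proof.
move=> cS dS; rewrite /= !inE negb_or => /andP[/andP[vc vd] _] [h1 h2].
rewrite /type2 (h1 v vS) (h1 c cS) (h1 d dS) /=; move: (h2 c cS); rewrite eq_sym vc => /(_ isT)/andP[-> ->].
by move: (h2 d dS); rewrite eq_sym vd => /(_ isT)/andP[-> ->].
Qed.

(** Maximality of [S] gives [p z] a neighbour in [S]; a frame containing that neighbour contradicts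
    [type1_type2]. *)
Lemma T1_T2_false x z : x \in R -> z \in R -> z != x -> z != p x -> T1 x -> T2 z -> False.
Proof.
move=> xR zR zx zpx t1 t2.
have [t tS tz] : exists2 t, t \in S & e t (p z).
  by apply: max_adj; move: zR; rewrite inE => /andP[].
have [c [d [cS dS u ht _]]] := pick_frame tS tS.
have := type1_type2 sym two (frame9 cS dS u xR zR zx zpx) (frame_K32 cS dS u) _
          (frame_type2 cS dS u t2).
rewrite /type1; have /andP[-> ->] := t1 _ vS; have /andP[-> ->] := t1 _ cS.
have /andP[-> ->] := t1 _ dS => /(_ isT)/negP; apply.
by move: ht tz; rewrite !inE => /or3P[] /eqP-> ->; rewrite ?orbT.
Qed.

(** Maximality of [S] gives [p x] and [p z] neighbours in [S], so [x] and [z] are non-adjacent by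
    [type2_type2]. Then [p (S \ v)] with [x] and [z] is independent and has [#|S| + 1] vertices. *)
Lemma T2_T2_false x z : x \in R -> z \in R -> z != x -> z != p x -> T2 x -> T2 z -> False.
Proof.
move=> xR zR zx zpx t1 t2.
have adj y : y \in R -> exists2 t, t \in S & e t (p y).
  by move=> yR; apply: max_adj; move: yR; rewrite inE => /andP[].
have [s sS sx] := adj x xR; have [t tS tz] := adj z zR.
have [c [d [cS dS u hs ht]]] := pick_frame sS tS.
have xz : ~~ e x z.
  apply: (type2_type2 sym two (frame9 cS dS u xR zR zx zpx) (frame_K32 cS dS u)
          (frame_type2 cS dS u t1) (frame_type2 cS dS u t2)).
    by move: hs sx; rewrite !inE => /or3P[] /eqP-> ->; rewrite ?orbT.
  by move: ht tz; rewrite !inE => /or3P[] /eqP-> ->; rewrite ?orbT.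
have S'x y : y \in R -> y \notin p @: (S :\ v).
  rewrite inE => /andP[_ pyS]; apply: contra pyS => /imsetP[a].
  by rewrite inE => /andP[_ aS] ->; rewrite pK.
have /maxS : independent e (x |: (z |: p @: (S :\ v))).
  have S'e y a : T2 y -> a \in p @: (S :\ v) -> ~~ e a y.
    by move=> [_ h] /imsetP[b] /setD1P[bv bS] ->; have /andP[] := h b bS bv.
  move=> a b /setU1P[->|/setU1P[->|aS]] /setU1P[->|/setU1P[->|bS]].
  - by rewrite irr.
  - by [].
  - by rewrite sym S'e.
  - by rewrite sym.
  - by rewrite irr.
  - by rewrite sym S'e.
  - by rewrite S'e.
  - by rewrite S'e.
  case/imsetP: aS => a' /setD1P[av aS] ->; case/imsetP: bS => b' /setD1P[bv bS] ->.
  exact: indep_S'.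
rewrite cardsU1 in_setU1 negb_or (eq_sym x) zx S'x //= cardsU1 S'x //=.
rewrite card_imset; last exact: can_inj pK.
by rewrite (cardsD1 v S) vS /= !add1n ltnn.
Qed.

Lemma R_single_edge : exists2 x, x \in R & forall z, z \in R -> z = x \/ z = p x.
Proof.
have [d dS dv] : exists2 d, d \in S & d \notin [:: v].
  by apply: exists_notin; apply: leq_trans S3.
rewrite inE in dv.
(* There are at least [2 * #|S| + 1] vertices, but [S] and [p (S \ v)] account for at most
   [2 * #|S| - 1]. *)
have := factor_critical_indep fc indS (pS dS dv).
have := cardsC (S :|: p @: (S :\ v)).
have : #|S :|: p @: (S :\ v)| <= #|S| + #|p @: (S :\ v)| by rewrite cardsU leq_subr.
rewrite card_imset; last exact: can_inj pK.
have := cardsD1 v S; rewrite vS => c1 c2 c3 c4.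
have /card_gt0P[x] : 0 < #|~: (S :|: p @: (S :\ v))| by lia.
rewrite !inE negb_or => /andP[xS xS'].
have xR : x \in R.
  rewrite inE xS /=; apply: contra xS' => pxS; rewrite -[x]pK; apply: imset_f.
  rewrite !inE pxS andbT; apply: contraNneq xS => pxv.
  by rewrite -[x]pK pxv pv.
exists x => // z zR.
have [->|zx] := eqVneq z x; first by left.
have [->|zpx] := eqVneq z (p x); first by right.
exfalso; have pzx : p z != x by apply: contraNneq zpx => <-; rewrite pK.
have pzpx : p z != p x by rewrite (can_eq pK).
(* Swapping the ends of an edge, or the two edges, reduces the nine combinations to the three
   exclusions. *)
have [t|[t|t]] := edge_types xR; have [t'|[t'|t']] := edge_types zR.
- exact: (T1_T1_false xR zR).
- exact: (T1_T2_false xR zR).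
- exact: (T1_T2_false xR (Rp zR)).
- by apply: (T1_T2_false zR xR) t' t; rewrite eq_sym.
- exact: (T2_T2_false xR zR).
- exact: (T2_T2_false xR (Rp zR)).
- by apply: (T1_T2_false zR (Rp xR)) t' t; rewrite eq_sym.
- by apply: (T2_T2_false (Rp xR) zR); rewrite ?pK.
- by apply: (T2_T2_false (Rp xR) (Rp zR)); rewrite ?pK.
Qed.

Lemma notin_S_cases x z : (forall z, z \in R -> z = x \/ z = p x) -> z \notin S ->
  [\/ z = x, z = p x | exists c, [/\ c \in S, c != v & z = p c]].
Proof.
move=> xR zS; have [pzS|pzS] := boolP (p z \in S); last first.
  by have [] := xR z; [rewrite inE zS pzS|constructor 1|constructor 2].
constructor 3; exists (p z); rewrite pK; split=> //.
by apply: contraNneq zS => pzv; rewrite -[z]pK pzv pv.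
Qed.

(** The complement of [S] consists of [x], [p x] and the independent set [p (S \ v)], so each of its
    edges meets [x] or [p x]. Two disjoint ones other than [{x, p x}] would match [x] and [p x] to
    some [p a] and [p b], leaving the independent triple [v], [a], [b]. *)
Lemma T1_in_G2 x : x \in R -> (forall z, z \in R -> z = x \/ z = p x) -> T1 x ->
  in_G2 e.
Proof.
move=> xR hR t1; exists S; split=> // [a y aS yS|].
  case: (notin_S_cases hR yS) => [->|->|[c [cS cv ->]]]; last exact: full_S'.
    by case/andP: (t1 a aS).
  by case/andP: (t1 a aS).
have [xS pxS] : x \notin S /\ p x \notin S by apply/andP; move: xR; rewrite inE.
apply: (@nu_eq1 e _ x (p x)); rewrite ?inE ?Re //.
  by apply: contraTneq (Re xR) => <-; rewrite irr.
have cross y a b : y \in R -> a \in S -> b \in S -> a != v -> b != v -> a != b ->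
    e (p a) y -> e (p b) (p y) -> False.
  move=> yR aS bS av bv ab h1 h2.
  have u : uniq [:: v; a; b] by rewrite /= !inE negb_or eq_sym av eq_sym bv ab.
  have /= := @two_edges7 e sym v _ (frame7 aS bS u yR) two 3 5 4 6 0 1 2 isT h1 h2.
  by rewrite /two_edges !(negPf (indS _ _)).
pose B := [:: x; p x].
have side a b : a \notin S -> b \notin S -> e a b -> (a \in B) || (b \in B).
  move=> aS bS; rewrite !inE.
  case: (notin_S_cases hR aS) => [->|->|[c [cS cv ->]]]; rewrite ?eqxx ?orbT //.
  case: (notin_S_cases hR bS) => [->|->|[c' [c'S c'v ->]]]; rewrite ?eqxx ?orbT //.
  by rewrite (negPf (indep_S' _ _ _ _)).
(* Disjoint edges take one vertex of [B] each, so their other ends lie in [p (S \ v)] and [cross]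
   applies. *)
have main a b c d : a \in B -> c \in B -> b \notin S -> d \notin S ->
    [&& a != c, a != d, b != c & b != d] -> e a b -> e c d -> False.
  move=> aB cB bS dS /and4P[ac ad bc bd] eab ecd.
  have Bac u : u \in B -> (u == a) || (u == c).
    move: aB cB ac; rewrite !inE => /orP[]/eqP-> /orP[]/eqP->; rewrite ?eqxx //.
    by rewrite orbC.
  have bB : b \notin B.
    by apply: contra bc => /Bac /orP[/eqP ba|//]; rewrite ba irr in eab.
  have dB : d \notin B.
    by apply: contra ad => /Bac /orP[|/eqP dc]; [rewrite eq_sym|rewrite dc irr in ecd].
  case: (notin_S_cases hR bS) bB => [->|->|[b' [b'S b'v bE]] _]; rewrite ?inE ?eqxx ?orbT //.
  case: (notin_S_cases hR dS) dB => [->|->|[d' [d'S d'v dE]] _]; rewrite ?inE ?eqxx ?orbT //.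
  have bd' : b' != d' by apply: contraNneq bd => h; rewrite bE dE h.
  have h1 : e (p b') a by rewrite -bE sym.
  have h2 : e (p d') c by rewrite -dE sym.
  move: aB cB ac h1 h2; rewrite !inE => /orP[]/eqP-> /orP[]/eqP->; rewrite ?eqxx // => _ h1 h2.
    exact: (cross x b' d').
  by apply: (cross (p x) b' d'); rewrite ?Rp ?pK.
move=> a b c d; rewrite !inE => aS bS cS dS /and4P[ac ad bc bd] eab ecd.
case/orP: (side a b aS bS eab) => h1; case/orP: (side c d cS dS ecd) => h2.
- by apply: (main a b c d) => //; apply/and4P.
- by apply: (main a b d c) => //; [apply/and4P|rewrite sym].
- by apply: (main b a c d) => //; [apply/and4P|rewrite sym].
- by apply: (main b a d c) => //; [apply/and4P|rewrite sym|rewrite sym].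
Qed.

(** The independent set is now [p (S \ v)] with [x]. Its complement is [S] with [p x], where every
    edge contains [p x]; maximality of [S] provides such an edge. *)
Lemma T2_in_G2 x : x \in R -> (forall z, z \in R -> z = x \/ z = p x) -> T2 x ->
  in_G2 e.
Proof.
move=> xR hR [t1 t2].
have [xS pxS] : x \notin S /\ p x \notin S by apply/andP; move: xR; rewrite inE.
have xS' : x \notin p @: (S :\ v).
  by apply: contra pxS => /imsetP[a /setD1P[_ aS] ->]; rewrite pK.
have S'P a : reflect (a = x \/ exists c, [/\ c \in S, c != v & a = p c])
                     (a \in x |: p @: (S :\ v)).
  apply: (iffP setU1P) => -[->|]; try by left.
    by case/imsetP=> c /setD1P[cv cS] ->; right; exists c.
  by case=> c [cS cv ->]; right; apply: imset_f; apply/setD1P.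
exists (x |: p @: (S :\ v)); split.
- move=> a b /S'P[->|[c [cS cv ->]]] /S'P[->|[d [dS dv ->]]].
  + by rewrite irr.
  + by rewrite sym; case/andP: (t2 d dS dv).
  + by case/andP: (t2 c cS cv).
  + exact: indep_S'.
- rewrite cardsU1 xS' card_imset; last exact: can_inj pK.
  by have := cardsD1 v S; rewrite vS; lia.
- move=> a y /S'P aS yS.
  have {}yS : y \in S \/ y = p x.
    have [|/(notin_S_cases hR) [yx|->|[c [cS cv yE]]]] := boolP (y \in S); [by left| |by right|].
      by case/S'P: yS; left.
    by case/S'P: yS; right; exists c.
  case: aS => [->|[c [cS cv ->]]]; case: yS => [yS|->].
  + by rewrite sym t1.
  + exact: Re.
  + by rewrite sym full_S'.
  + by case/andP: (t2 c cS cv).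
have cmp a : a \in ~: (x |: p @: (S :\ v)) -> a != p x -> a \in S.
  rewrite inE => /S'P na apx; apply: contraT => /(notin_S_cases hR)[ax|ax|[c h]].
  - by case: na; left.
  - by rewrite ax eqxx in apx.
  - by case: na; right; exists c.
have [t tS tx] := max_adj pxS.
have cmpS a : a \in S -> a \in ~: (x |: p @: (S :\ v)).
  move=> aS; rewrite inE; apply/S'P => -[ax|[c [cS cv ac]]].
    by rewrite -ax aS in xS.
  by have := pS cS cv; rewrite -ac aS.
apply: (@nu_eq1 e _ t (p x)) => //; first exact: cmpS.
- rewrite inE; apply/S'P => -[h|[c [cS cv /(can_inj pK) xc]]].
    by have := Re xR; rewrite h irr.
  by rewrite xc cS in xS.
- by apply: contraNneq pxS => <-.
move=> a b c d aA bA cA dA /and4P[ac ad bc bd] eab ecd.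
have edge y z : y \in ~: (x |: p @: (S :\ v)) -> z \in ~: (x |: p @: (S :\ v)) ->
    e y z -> (y == p x) || (z == p x).
  move=> yA zA; apply: contraTT; rewrite negb_or => /andP[ny nz].
  by apply: indS; apply: cmp.
case/orP: (edge a b aA bA eab) ac ad bc bd => /eqP->;
  by case/orP: (edge c d cA dA ecd) => /eqP->; rewrite eqxx.
Qed.

Lemma structure_in_G2 : in_G2 e.
Proof.
have [x xR hR] := R_single_edge.
have [t|[t|t]] := edge_types xR; first exact: T1_in_G2 t.
  exact: T2_in_G2 t.
by apply: T2_in_G2 t; rewrite ?Rp // => z /hR[]->; [right; rewrite pK|left].
Qed.

End Structure.
End Matchings.

(** * Graphs in which no vertex has two non-neighbours *)

Lemma complete_odd_or_in_G1 (T : finType) (e : rel T) : symmetric e -> irreflexive e -> 7 <= #|T| ->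
  odd #|T| -> (forall x y z, x != y -> x != z -> y != z -> e x y || e x z) ->
  complete_odd e \/ in_G1 e.
Proof.
move=> sym irr T7 oT cd1.
have [/forallP full|] := boolP [forall x, [forall y, (x != y) ==> e x y]].
  by left; split=> // x y; move/forallP: (full x) => /(_ y)/implyP.
rewrite negb_forall => /existsP[x0]; rewrite negb_forall => /existsP[y0].
rewrite negb_imply => /andP[xy0 exy0]; right; exists #|T|./2; split; first by lia.
have cT : #|T| = 2 * #|T|./2 + 1 by lia.
pose f x := cast_ord cT (enum_rank x).
have fI : injective f by move=> x y /cast_ord_inj/enum_rank_inj.
exists f; split.
  by apply: inj_card_bij => //; rewrite card_ord -cT.
pose N := [set w : T * T | (w.1 != w.2) && ~~ e w.1 w.2].
(* The removed edges are the non-adjacent pairs; two of them sharing a vertex would give it two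
   non-neighbours. *)
exists [set [set f w.1; f w.2] | w in N]; split.
- apply/matchingP; split.
    move=> g /imsetP[[x y]]; rewrite inE /= => /andP[xy _] ->; exists (f x), (f y).
    by rewrite /complete_rel (inj_eq fI) xy.
  apply/trivIsetP => g h /imsetP[[x y]] + -> /imsetP[[z w]] + ->.
  rewrite !inE /= => /andP[xy exy] /andP[zw ezw].
  have uni a b c : a != b -> ~~ e a b -> a != c -> ~~ e a c -> b = c.
    move=> ab eab ac eac; apply/eqP; apply: contraT => bc.
    by have := cd1 a b c ab ac bc; rewrite (negPf eab) (negPf eac).
  apply: contraR => /pred0Pn[q /= /andP[/set2P[->|->] /set2P[/fI h'|/fI h']]]; subst.
  + by rewrite (uni z y w).
  + by rewrite (uni w y z) // 1?eq_sym 1?sym // setUC.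
  + by rewrite (uni z x w) // 1?eq_sym 1?sym // setUC.
  + by rewrite (uni w x z) // 1?eq_sym // sym.
- by apply/set0Pn; exists [set f x0; f y0]; apply: (imset_f _ (x := (x0, y0))); rewrite inE xy0.
move=> x y; rewrite (inj_eq fI); have [->|xy] := eqVneq x y; first by rewrite irr.
apply/idP/idP => [exy|].
  apply/imsetP => -[[z w]]; rewrite inE /= => /andP[zw ezw] /setP E.
  have := E (f x); have := E (f y); rewrite !inE !eqxx !orbT !(inj_eq fI).
  move=> /esym/orP[]/eqP yE /esym/orP[]/eqP xE; subst; rewrite ?eqxx // in xy.
    by rewrite sym exy in ezw.
  by rewrite exy in ezw.
apply: contraR => exy; apply: (imset_f _ (x := (x, y))); by rewrite inE xy.
Qed.

(** * Both directions of the characterisation *)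

Theorem theorem3p6 (T : finType) (e : rel T) :
  symmetric e -> irreflexive e -> 7 <= #|T| -> factor_critical e ->
  (ESE e <-> complete_odd e \/ in_G1 e \/ in_G2 e).
Proof.
move=> sym irr T7 fc; have oT : odd #|T| by apply: factor_critical_odd; first lia.
split=> [ese|]; last first.
  case=> [[full _]|[|g2]]; last exact: in_G2_ESE.
    by apply: complement_matching_ESE => // x y z /full->.
  case=> r [_ [f [fB [M [/matchingP[_ /trivIsetP dM] _ eE]]]]].
  apply: complement_matching_ESE => // x y z xy xz yz.
  have fI := bij_inj fB.
  rewrite !eE !(inj_eq fI) xy xz /= -negb_and; apply/negP => /andP[h1 h2].
  have /(dM _ _ h1 h2)/pred0P/(_ (f x)) : [set f x; f y] != [set f x; f z].
    apply/eqP => /setP/(_ (f y)); rewrite !inE !(inj_eq fI) eqxx orbT.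
    by rewrite eq_sym (negPf xy) (negPf yz).
  by rewrite /= !inE eqxx.
have two x y z : matched_off e [:: x; y; z] -> two_edges e x y z.
  exact: ESE_matched_off3.
have [|] := boolP [forall x, forall y, forall z,
    [&& x != y, x != z & y != z] ==> e x y || e x z].
  move=> /forallP h; suff [|] : complete_odd e \/ in_G1 e by auto.
  apply: complete_odd_or_in_G1 => // x y z xy xz yz.
  by move/forallP: (h x) => /(_ y)/forallP/(_ z); rewrite xy xz yz.
rewrite negb_forall => /existsP[v]; rewrite negb_forall => /existsP[a].
rewrite negb_forall => /existsP[b]; rewrite negb_imply negb_or.
move=> /andP[/and3P[va vb ab] /andP[nva nvb]]; right; right.
(* If no triple is independent, the non-neighbours [a], [b] of [v] are adjacent. With their partners
   [a'], [b'] in a perfect matching of [G - v] they form a house, and a further matching edge [xy]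
   contradicts [house_false]. *)
have [S0 [iS0 cS0]] : exists S, independent e S /\ 3 <= #|S|.
  have [/existsP[x /existsP[y /existsP[z /andP[u /and3P[xy xz yz]]]]]|] :=
    boolP [exists x, exists y, exists z,
      uniq [:: x; y; z] && [&& ~~ e x y, ~~ e x z & ~~ e y z]].
    exists [set w in [:: x; y; z]]; split; last by rewrite cardsE (card_uniqP u).
    move=> w w'; rewrite !inE => /or3P[]/eqP-> /or3P[]/eqP->; rewrite ?irr //.
    - by rewrite sym.
    - by rewrite sym.
    - by rewrite sym.
  move=> noind; exfalso.
  have tri x y z : uniq [:: x; y; z] -> [|| e x y, e x z | e y z].
    move=> u; apply: contraT; rewrite !negb_or => h; case/negP: noind.
    by apply/existsP; exists x; apply/existsP; exists y; apply/existsP; exists z; rewrite u.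
  have uvab : uniq [:: v; a; b] by rewrite /= !inE negb_or va vb ab.
  have eab : e a b by have := tri v a b uvab; rewrite (negPf nva) (negPf nvb).
  have [|a' aa' m3] := matched_off_extend irr (factor_critical_matched_off v sym fc) (z := a).
    by rewrite inE eq_sym.
  (* Were [a] and [b] matched to each other, releasing them would leave [v], [a], [b] with the
     single edge [ab]. *)
  have ba' : b != a'.
    apply/eqP => h; move: m3; rewrite -h => /two.
    by rewrite /two_edges ![e _ v]sym (negPf nva) (negPf nvb) !andbF.
  have [|b' bb' m5] := matched_off_extend irr m3 (z := b).
    by rewrite !inE !negb_or eq_sym ab ba' eq_sym vb.
  have [|x _ xm5] := @exists_notin T [set: T] [:: b; b'; a; a'; v].
    by rewrite cardsT; apply: leq_trans T7.
  have [y xy m7] := matched_off_extend irr m5 xm5.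
  (* The list is put in the order [v], [a], [b], [a'], [b'], [x], [y] expected by [house_false]. *)
  have mL := matched_off_idx v m7 (i := [:: 6; 4; 2; 5; 3; 0; 1]) isT.
  have k := @two_edges7 T e sym v _ mL two.
  apply: (house_false sym two mL tri _ xy).
  have va' : e v a'.
    have /= := k 2 4 5 6 0 1 3 isT bb' xy.
    by rewrite /two_edges (negPf nva); case: (e v a').
  have vb' : e v b'.
    have /= := k 1 3 5 6 0 2 4 isT aa' xy.
    by rewrite /two_edges (negPf nvb); case: (e v b').
  have a'b' : ~~ e a' b'.
    apply/negP => h; have /= := k 3 4 5 6 0 1 2 isT h xy.
    by rewrite /two_edges (negPf nva) (negPf nvb).
  rewrite /house va' vb' eab aa' bb' nva nvb a'b' /=; apply/eqP; apply/idP/idP => h.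
    have /= := k 1 4 5 6 0 2 3 isT h xy.
    by rewrite /two_edges (negPf nvb); case: (e b a'); rewrite ?andbF.
  have /= := k 2 3 5 6 0 1 4 isT h xy.
  by rewrite /two_edges (negPf nva); case: (e a b'); rewrite ?andbF.
(* Independence in boolean form, as needed to select an independent set of maximum size. *)
pose indb (S : {set T}) := [forall x in S, forall y in S, ~~ e x y].
have indbP S : reflect (independent e S) (indb S).
  apply: (iffP forall_inP) => [h x y xS yS|h x xS].
    by move/forall_inP: (h x xS); apply.
  by apply/forall_inP => y; apply: h.
have [S /indbP indS maxS] := arg_maxnP (fun S : {set T} => #|S|) (introT (indbP S0) iS0).
have S3 : 3 <= #|S| by apply: leq_trans (maxS S0 _) => //; apply/indbP.
have [w wS] : exists w, w \in S by apply/card_gt0P; lia.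
have [_ [p pp]] := factor_critical_matched_off w sym fc.
by apply: (structure_in_G2 sym irr fc two indS S3 wS _ pp) => S' /indbP /maxS.
Qed.
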